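(* Let $G$ be a graph of order $n\ge 3$. Then $C_t^{oi}(G)\le n-\tau(G)+2$.
   Context: All graphs are finite, simple and undirected, with vertex set $V(G)$; the order is $|V(G)|$, and $\tau(G)$ is the vertex cover number (minimum number of vertices required to cover all edges of $G$). A set $D\subseteq V(G)$ is a total outer-independent dominating set (TOIDS) of $G$ if every vertex of $G$ is adjacent to at least one vertex of $D$ and $V(G)\setminus D$ is an independent set of $G$. Two nonempty disjoint sets $X,Y\subseteq V(G)$ form a TOI-coalition (are TOI-coalition partners) if neither $X$ nor $Y$ is a TOIDS of $G$ but $X\cup Y$ is a TOIDS of $G$. A TOI-coalition partition of $G$ is a partition $\Psi=\{V_1,\dots,V_k\}$ of $V(G)$ into nonempty sets such that for every $V_i\in\Psi$ there exists $V_j\in\Psi$, $j\ne i$, such that $V_i$ and $V_j$ form a TOI-coalition. The TOI-coalition number $C_t^{oi}(G)$ is the maximum cardinality of a TOI-coalition partition of $G$, with $C_t^{oi}(G)=0$ if $G$ has no TOI-coalition partition. *)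

(* Defs.v *)
From mathcomp Require Import all_boot.

Set Implicit Arguments.
Unset Strict Implicit.
Unset Printing Implicit Defensive.

(* A finite simple graph is a symmetric irreflexive relation
   [e] on a finType [T], so that its vertex set is all of [T]. *)

Definition independent_set (T : finType) (e : rel T) (S : {set T}) : bool :=
  [forall u in S, forall v in S, ~~ e u v].

Definition vertex_cover (T : finType) (e : rel T) (C : {set T}) : bool :=
  [forall u, forall v, e u v ==> (u \in C) || (v \in C)].

(* [set: T] is always a vertex cover, so the minimum is attained. *)
Definition vertex_cover_number (T : finType) (e : rel T) : nat :=
  #|[arg min_(C < [set: T] | vertex_cover e C) #|C|]|.

Definition total_dominating (T : finType) (e : rel T) (D : {set T}) : bool :=
  [forall v, exists u in D, e v u].

Definition toids (T : finType) (e : rel T) (D : {set T}) : bool :=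
  total_dominating e D && independent_set e (~: D).

Definition toi_coalition (T : finType) (e : rel T) (X Y : {set T}) : bool :=
  [&& X != set0, Y != set0, [disjoint X & Y],
      ~~ toids e X, ~~ toids e Y & toids e (X :|: Y)].

(* [partition] already requires the blocks to be nonempty. *)
Definition toi_coalition_partition (T : finType) (e : rel T)
    (Psi : {set {set T}}) : bool :=
  partition Psi [set: T] &&
  [forall X in Psi, exists Y in Psi, (Y != X) && toi_coalition e X Y].

(* The maximum over an empty range is 0, which is the value wanted when the
   graph has no such partition. *)
Definition toi_coalition_number (T : finType) (e : rel T) : nat :=
  \max_(Psi : {set {set T}} | toi_coalition_partition e Psi) #|Psi|.

(* Main.v *)
Require Import Defs.
From mathcomp Require Import all_boot zify.

(** A partition with at least one block has two blocks [X] and [Y] whose union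
    is a total outer-independent dominating set.  The complement of this union
    is independent, so the union is a vertex cover and has at least as many
    vertices as a minimum one ([toids_card]).  Every other block takes at least
    one vertex outside [X :|: Y], so there are at most [#|T| - #|X :|: Y|] of
    them ([card_partition_two_blocks]); [X] and [Y] themselves account for the
    summand 2. *)

Lemma independent_setC_vertex_cover {T : finType} {e : rel T} {D : {set T}} :
  independent_set e (~: D) -> vertex_cover e D.
Proof.
move=> /forall_inP indD; apply/forallP => u; apply/forallP => v.
apply/implyP => euv; case: (boolP (u \in D)) => //= uD.
apply: contraLR euv => vD.
have {}uD : u \in ~: D by rewrite inE.
by move/forall_inP: (indD u uD) => -> //; rewrite inE.
Qed.

Lemma vertex_cover_number_le {T : finType} {e : rel T} {C : {set T}} :
  vertex_cover e C -> vertex_cover_number e <= #|C|.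
Proof.
rewrite /vertex_cover_number => covC; case: arg_minnP => [|M _ minM].
  by apply/forallP => u; apply/forallP => v; rewrite !inE implybT.
exact: minM.
Qed.

Lemma toids_card {T : finType} {e : rel T} {D : {set T}} :
  toids e D -> vertex_cover_number e <= #|D|.
Proof.
move=> /andP[_ indD].
exact/vertex_cover_number_le/independent_setC_vertex_cover.
Qed.

(** Each of the [#|P| - 2] blocks other than [X] and [Y] has an element, and
    these elements are distinct and lie outside [X :|: Y]. *)
Lemma card_partition_two_blocks {T : finType} {P : {set {set T}}}
    {D X Y : {set T}} :
  partition P D -> X \in P -> Y \in P -> Y != X ->
  #|P| + #|X :|: Y| <= #|D| + 2.
Proof.
move=> partP XP YP YX.
have YPX : Y \in P :\ X by rewrite !inE YX.
have le_rest : #|P :\ X :\ Y| <= \sum_(B in P :\ X :\ Y) #|B|.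
  rewrite -sum1_card; apply: leq_sum => B /setD1P[_ /setD1P[_ BP]].
  by rewrite card_gt0 (partition_neq0 partP).
have leU : #|X :|: Y| <= #|X| + #|Y| by rewrite cardsU leq_subr.
have cardP : #|P| = #|P :\ X :\ Y| + 2.
  by rewrite (cardsD1 X P) XP (cardsD1 Y (P :\ X)) YPX addnA addnC.
have cardD : #|D| = #|X| + #|Y| + \sum_(B in P :\ X :\ Y) #|B|.
  by rewrite (card_partition partP) (big_setD1 X XP) (big_setD1 Y YPX) /= addnA.
rewrite cardP cardD; lia.
Qed.

Theorem corollary2 (T : finType) (e : rel T)
    (e_sym : symmetric e) (e_irr : irreflexive e) (n_ge3 : 3 <= #|T|) :
  toi_coalition_number e <= #|T| - vertex_cover_number e + 2.
Proof.
apply/bigmax_leqP => Psi /andP[partPsi /forall_inP partner].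
have [-> | [X XPsi]] := set_0Vmem Psi; first by rewrite cards0.
have /exists_inP[Y YPsi /andP[YX]] := partner X XPsi.
case/and5P=> _ _ _ _ /andP[_ toidsXY].
have le_cards := card_partition_two_blocks partPsi XPsi YPsi YX.
have le_tau := toids_card toidsXY.
have le_T := max_card (X :|: Y).
rewrite cardsT in le_cards.
lia.
Qed.
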